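(* Let $\Psi=\{f_1,\dots,f_m\}$ be a system of contracting similitudes of $\mathbb{R}^n$ with attractor $E$ satisfying the Strong Separation Condition, and let $r_{\min}, r_{\max}, c, R, s, C^s(E), \tilde m_k$ be as defined in the context. Then, for every $k\in\mathbb{N}^+$, $$|C^{s}(E)-\tilde{m}_{k}|\leq \epsilon_{k},\qquad \epsilon_{k}:=\frac{s\,2^{s+1}R\,\mathcal{Q}}{r_{\min}^{qs}}\,r_{\max}^{k},$$ where $s=\dim_H(E)$, $q\in\mathbb{N}^+$ is such that $Rr_{\max}^{q}\leq c<Rr_{\max}^{q-1}$, and $$\mathcal{Q}:=\begin{cases}R^{s-1} & \text{if } s\geq 1,\\ c^{s-1} & \text{if } s<1.\end{cases}$$
   Context: $\mathbb{N}^+=\{1,2,3,\dots\}$. Let $m\ge 2$, $M=\{1,\dots,m\}$, and let $f_i:\mathbb{R}^n\to\mathbb{R}^n$ ($i\in M$) be contracting similitudes with similarity ratios $r_i\in(0,1)$, i.e. $|f_i(x)-f_i(y)|=r_i|x-y|$. The attractor $E$ is the unique non-empty compact set with $E=\bigcup_{i=1}^m f_i(E)$. The Strong Separation Condition (SSC) means $f_i(E)\cap f_j(E)=\emptyset$ for all $i\ne j$ in $M$. Put $r_{\min}=\min_i r_i$, $r_{\max}=\max_i r_i$, $c:=\min_{i\ne j}\inf\{|x-y|:x\in f_i(E),\,y\in f_j(E)\}>0$, and let $R$ be the diameter of $E$. The number $s$ is the unique solution of $\sum_{i=1}^m r_i^s=1$ (the similarity dimension), which under the SSC equals the Hausdorff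 dimension $\dim_H(E)$. Words: for $\mathbf{i}=(i_1,\dots,i_k)\in M^k$ put $f_{\mathbf{i}}=f_{i_1}\circ\cdots\circ f_{i_k}$, $r_{\mathbf{i}}=r_{i_1}\cdots r_{i_k}$, $E_{\mathbf{i}}=f_{\mathbf{i}}(E)$. $\mu$ is the natural probability measure on $E$, i.e. the Borel probability measure with $\mu(E_{\mathbf{i}})=r_{\mathbf{i}}^s$ for every finite word $\mathbf{i}$. $\bar B(x,d)=\{y\in\mathbb{R}^n:|x-y|\le d\}$. Centered Hausdorff measure: $C^s(A)=\sup\{C_0^s(F):F\subset A\}$, where $C_0^s(F)=\lim_{\delta\to0}\inf\{\sum_i(2d_i)^s\}$, the infimum being over countable covers of $F$ by closed balls $\bar B(x_i,d_i)$ with $x_i\in F$ and $2d_i\le\delta$. Instead of the standard definition, the paper works with the following relation, known from earlier work for self-similar sets satisfying the SSC: $C^s(E)=\min\{(2d)^s/\mu(\bar B(x,d)):x\in E,\ c\le d\le R\}$. Approximating points and measures: $A_1$ is the set of the $m$ fixed points of $f_1,\dots,f_m$, and $A_k=\bigcup_{i\in M}f_i(A_{k-1})$ for $k\ge2$; $A_k$ has $m^k$ points, exactly one in each $E_{\mathbf{i}}$, $\mathbf{i}\in M^k$. For $x\in A_k$ let $\mathbf{i}_k^x=(i_1^x,\dots,i_k^x)\in M^k$ be the unique word with $x\in E_{\mathbf{i}_k^x}$. Let $\mu_k=\sum_{x\in A_k}r_{\mathbf{i}_k^x}^s\,\delta_x$ ($\delta_x$ = unit point mass at $x$), a probability measure.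 For $x\in A_k$ let $\bar D_k^x$ be the set of all $d=|x-y|$ with $y\in A_k$ such that there exists $z\in A_k\cap\bar B(x,d)$ with $i_1^z\ne i_1^x$. Put $\bar h_k(x,d)=\dfrac{(2d)^s}{\mu_k(\bar B(x,d))}$ and define (the output of the centered Hausdorff measure algorithm at step $k$) $$\tilde m_k:=\min_{x\in A_k}\ \min_{d\in\bar D_k^x}\bar h_k(x,d).$$ *)

(* Defs.v *)
From mathcomp Require Import all_boot all_order all_algebra.
From mathcomp Require Import all_classical all_reals all_analysis.
Set Implicit Arguments.
Unset Strict Implicit.
Unset Printing Implicit Defensive.
Import Order.TTheory GRing.Theory Num.Theory.
Import numFieldNormedType.Exports.
Local Open Scope classical_set_scope.
Local Open Scope ring_scope.

(* The library norm on 'rV[R]_n is the sup norm, so Euclidean distances and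
   balls are introduced here. Compactness in 'rV[R]_n is taken in the library's
   product topology, which is also the topology of the Euclidean distance. *)
Definition edist (R : realType) (n : nat) (x y : 'rV[R]_n) : R :=
  Num.sqrt (\sum_(j < n) (x ord0 j - y ord0 j) ^+ 2).

Definition cball (R : realType) (n : nat) (x : 'rV[R]_n) (d : R) :
    set 'rV[R]_n :=
  [set y | edist x y <= d].

Definition diam (R : realType) (n : nat) (A : set 'rV[R]_n) : R :=
  sup [set t | exists x y, [/\ A x, A y & t = edist x y]].

Definition setdist (R : realType) (n : nat) (A B : set 'rV[R]_n) : R :=
  inf [set t | exists x y, [/\ A x, B y & t = edist x y]].

(* The countable cover is (cball (x i) (d i)) for i in I, where I is any set of
   naturals, so that finite covers (and the empty cover of set0) are allowed. *)
Definition centered_cover (R : realType) (n : nat) (F : set 'rV[R]_n)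
    (delta : R) (I : set nat) (x : nat -> 'rV[R]_n) (d : nat -> R) : Prop :=
  (forall i, I i -> [/\ F (x i), 0 < d i & 2 * d i <= delta]) /\
  F `<=` \bigcup_(i in I) cball (x i) (d i).

Definition centered_premeasure_at (R : realType) (n : nat) (s : R)
    (F : set 'rV[R]_n) (delta : R) : \bar R :=
  ereal_inf [set v | exists I x d, centered_cover F delta I x d /\
    v = (\esum_(i in I) ((2 * d i) `^ s)%:E)%E].

Definition centered_premeasure (R : realType) (n : nat) (s : R)
    (F : set 'rV[R]_n) : \bar R :=
  lim (centered_premeasure_at s F delta @[delta --> 0^'+]).

Definition centered_hausdorff (R : realType) (n : nat) (s : R)
    (A : set 'rV[R]_n) : \bar R :=
  ereal_sup [set centered_premeasure s F | F in [set F | F `<=` A]].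

(* 'I_m is the alphabet, and words are sequences over it. *)

Definition contracting_similitude (R : realType) (n : nat)
    (f : 'rV[R]_n -> 'rV[R]_n) (r : R) : Prop :=
  0 < r < 1 /\ forall x y, edist (f x) (f y) = r * edist x y.

Definition is_attractor (R : realType) (n m : nat)
    (f : 'I_m -> 'rV[R]_n -> 'rV[R]_n) (E : set 'rV[R]_n) : Prop :=
  [/\ E !=set0, compact E & E = \bigcup_i (f i @` E)].

Definition strong_separation (R : realType) (n m : nat)
    (f : 'I_m -> 'rV[R]_n -> 'rV[R]_n) (E : set 'rV[R]_n) : Prop :=
  forall i j, i != j -> f i @` E `&` f j @` E = set0.

(* The ratios lie in ]0, 1[, so the neutral values 1 and 0 do not affect the
   minimum and the maximum. *)
Definition rmin (R : realType) (m : nat) (r : 'I_m -> R) : R :=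
  \big[Num.min/1]_i r i.

Definition rmax (R : realType) (m : nat) (r : 'I_m -> R) : R :=
  \big[Num.max/0]_i r i.

(* For m >= 2 the outer inf is over a finite nonempty set: it is a minimum. *)
Definition separation (R : realType) (n m : nat)
    (f : 'I_m -> 'rV[R]_n -> 'rV[R]_n) (E : set 'rV[R]_n) : R :=
  inf [set t | exists i j, i != j /\ t = setdist (f i @` E) (f j @` E)].

Definition word_map (R : realType) (n m : nat)
    (f : 'I_m -> 'rV[R]_n -> 'rV[R]_n) (w : seq 'I_m) :
    'rV[R]_n -> 'rV[R]_n :=
  foldr (fun i g => f i \o g) id w.

Definition word_ratio (R : realType) (m : nat) (r : 'I_m -> R)
    (w : seq 'I_m) : R :=
  \prod_(i <- w) r i.

(* Only indices k >= 1 are meaningful; the value at 0 is a dummy. *)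
Fixpoint approx_pts (R : realType) (n m : nat)
    (f : 'I_m -> 'rV[R]_n -> 'rV[R]_n) (k : nat) : set 'rV[R]_n :=
  match k with
  | 0%N => set0
  | 1%N => [set x | exists i, f i x = x]
  | k'.+1 => \bigcup_i (f i @` approx_pts f k')
  end.

(* Under strong separation, the unique word w of length k with x in E_w,
   for x in approx_pts f k. *)
Definition word_of (R : realType) (n m : nat)
    (f : 'I_m -> 'rV[R]_n -> 'rV[R]_n) (E : set 'rV[R]_n) (k : nat)
    (x : 'rV[R]_n) : seq 'I_m :=
  xget [::] [set w | size w = k /\ (word_map f w @` E) x].

Definition approx_measure (R : realType) (n m : nat)
    (f : 'I_m -> 'rV[R]_n -> 'rV[R]_n) (r : 'I_m -> R) (E : set 'rV[R]_n)
    (s : R) (k : nat) (B : set 'rV[R]_n) : R :=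
  \sum_(x \in approx_pts f k)
     word_ratio r (word_of f E k x) `^ s * \1_B x.

Definition admissible_radii (R : realType) (n m : nat)
    (f : 'I_m -> 'rV[R]_n -> 'rV[R]_n) (E : set 'rV[R]_n) (k : nat)
    (x : 'rV[R]_n) : set R :=
  [set d | exists y, [/\ approx_pts f k y, d = edist x y &
    exists z, [/\ approx_pts f k z, cball x d z &
      ohead (word_of f E k z) != ohead (word_of f E k x)]]].

Definition approx_ratio (R : realType) (n m : nat)
    (f : 'I_m -> 'rV[R]_n -> 'rV[R]_n) (r : 'I_m -> R) (E : set 'rV[R]_n)
    (s : R) (k : nat) (x : 'rV[R]_n) (d : R) : R :=
  (2 * d) `^ s / approx_measure f r E s k (cball x d).

(* Both infima are over finite nonempty sets (for k >= 1 and m >= 2, under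
   strong separation): they are minima. *)
Definition approx_centered_hausdorff (R : realType) (n m : nat)
    (f : 'I_m -> 'rV[R]_n -> 'rV[R]_n) (r : 'I_m -> R) (E : set 'rV[R]_n)
    (s : R) (k : nat) : R :=
  inf [set inf [set approx_ratio f r E s k x d
                 | d in admissible_radii f E k x]
        | x in approx_pts f k].

Definition Qconst (R : realType) (s diamE c : R) : R :=
  if 1 <= s then diamE `^ (s - 1) else c `^ (s - 1).

Definition error_bound (R : realType) (s diamE c r_min r_max : R)
    (q k : nat) : R :=
  s * 2 `^ (s + 1) * diamE * Qconst s diamE c / r_min `^ (q%:R * s)
    * r_max ^+ k.

(* Main.v *)
(* No limit measure is needed: everything is expressed with the masses r_w^s of
   words w of a fixed length.
   Upper bound. Let x be the point of A_k with word u, let d be admissible, let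
   G be the set of the words of the points of A_k in the ball B(x, d), and put
   D = min(d + 2 R r_max^k, R), so that any point of E_u is within D of any
   point of E_v, v in G. To cover F with small balls centred in F, process the
   cylinders E_w of a deep level: if F meets E_wu, one ball centred there, of
   radius r_w D, covers all the E_wv, v in G, at the cost (2D)^s / mass(G) per
   unit of mass; otherwise E_wu is dropped. The mass left over shrinks
   geometrically, so C^s(E) <= (2D)^s / mass(G).
   Lower bound. By self-similarity a ball centred in E may be rescaled until it
   meets two first-level pieces; then its radius is at least c, and comparing it
   with the farthest point of A_k whose cylinder it meets bounds the mass of the
   words it hits by (2d)^s / (m_k - eps_k). Sum over a finite subcover.
   In both cases the radius changes by at most 2 R r_max^k while staying in
   [c, R], and the mass involved is at least r_min^(qs): this gives eps_k. *)
Require Import Defs.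
From mathcomp Require Import all_boot all_order all_algebra.
From mathcomp Require Import all_classical all_reals all_analysis.
From mathcomp Require Import ring lra.
(* Imported again because [edist] is also the name of an extended distance of
   the library. *)
Import Defs.
Set Implicit Arguments.
Unset Strict Implicit.
Unset Printing Implicit Defensive.
Import Order.TTheory GRing.Theory Num.Theory.
Import numFieldNormedType.Exports.
Local Open Scope classical_set_scope.
Local Open Scope ring_scope.

(** * The Euclidean distance: metric axioms, continuity and open balls *)

Section EuclideanDistance.
Variables (R : realType) (n : nat).
Implicit Types (x y z : 'rV[R]_n) (d : R).

(** Lagrange's identity: twice the difference of the two sides is the double sum of the squares of
    a_i b_j - a_j b_i. *)
Lemma sum_mul_sqr_le (a b : 'I_n -> R) :
  (\sum_i a i * b i) ^+ 2 <= (\sum_i a i ^+ 2) * (\sum_i b i ^+ 2).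
Proof.
have dbl (F : 'I_n -> 'I_n -> R) : \sum_i \sum_j (F i j + F j i) =
    2 * \sum_i \sum_j F i j.
  under eq_bigr => i _ do rewrite big_split /=.
  by rewrite big_split /= [X in _ + X]exchange_big /= mulr2n mulrDl mul1r.
have : 0 <= \sum_i \sum_j (a i * b j - a j * b i) ^+ 2.
  by apply: sumr_ge0 => i _; apply: sumr_ge0 => j _; exact: sqr_ge0.
have -> : \sum_i \sum_j (a i * b j - a j * b i) ^+ 2 =
    2 * \sum_i \sum_j (a i ^+ 2 * b j ^+ 2 - a i * b i * (a j * b j)).
  rewrite -dbl; apply: eq_bigr => i _; apply: eq_bigr => j _; ring.
under eq_bigr => i _ do rewrite big_split /= sumrN -!mulr_sumr.
rewrite big_split /= sumrN -!mulr_suml -expr2.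
lra.
Qed.

Lemma edist_ge0 x y : 0 <= edist x y.
Proof. exact: sqrtr_ge0. Qed.

Lemma edistC x y : edist x y = edist y x.
Proof.
by rewrite /edist; congr Num.sqrt; apply: eq_bigr => j _; rewrite -sqrrN opprB.
Qed.

Lemma edistxx x : edist x x = 0.
Proof. by rewrite /edist big1 ?sqrtr0// => j _; rewrite subrr expr0n. Qed.

(** After squaring, only the cross terms differ, and they are compared by [sum_mul_sqr_le]. *)
Lemma edist_triangle x y z : edist x z <= edist x y + edist y z.
Proof.
have sq_ge0 (u v : 'rV[R]_n) : 0 <= \sum_j (u ord0 j - v ord0 j) ^+ 2.
  by apply: sumr_ge0 => j _; exact: sqr_ge0.
rewrite -(@ler_pXn2r _ 2) ?nnegrE ?addr_ge0 ?edist_ge0//.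
rewrite sqrrD !sqr_sqrtr//.
set a := fun j => x ord0 j - y ord0 j; set b := fun j => y ord0 j - z ord0 j.
have -> : \sum_j (x ord0 j - z ord0 j) ^+ 2 =
    \sum_j a j ^+ 2 + (\sum_j a j * b j) *+ 2 + \sum_j b j ^+ 2.
  rewrite -sumrMnl -!big_split /=; apply: eq_bigr => j _; rewrite /a /b; ring.
rewrite lerD2r lerD2l lerMn2r /= /edist -sqrtrM//.
rewrite (le_trans (ler_norm _))// -sqrtr_sqr.
by rewrite ler_sqrt ?sum_mul_sqr_le// ?mulr_ge0 ?sq_ge0.
Qed.

Lemma edist_eq0 x y : edist x y <= 0 -> x = y.
Proof.
rewrite le_eqVlt ltNge edist_ge0 orbF sqrtr_eq0 => le0; apply/rowP => j; apply/eqP.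
rewrite -subr_eq0 -sqrf_eq0; apply/eqP.
have sq_ge0 (i : 'I_n) : true -> 0 <= (x ord0 i - y ord0 i) ^+ 2.
  by move=> _; exact: sqr_ge0.
have /eqP : \sum_j (x ord0 j - y ord0 j) ^+ 2 = 0.
  by apply/eqP; rewrite eq_le le0 sumr_ge0.
by rewrite psumr_eq0// => /allP/(_ j (mem_index_enum j))/eqP.
Qed.

Lemma edist_continuous x : continuous (edist x).
Proof.
have cont : continuous (fun y : 'rV[R]_n => \sum_j (x ord0 j - y ord0 j) ^+ 2).
  apply: (continuous_big (op := +%R)); first by move=> p; exact: add_continuous.
  move=> j _ y; apply: (@continuous_comp _ _ _ (fun y : 'rV[R]_n => x ord0 j - y ord0 j)
      (fun t : R => t ^+ 2)).
    have cj : continuous (fun y : 'rV[R]_n => y ord0 j) by exact: coord_continuous.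
    exact: (continuousB (@cst_continuous _ _ (x ord0 j) y) (cj y)).
  exact: exprn_continuous.
move=> y; apply: (@continuous_comp _ _ _ (fun y : 'rV[R]_n =>
    \sum_j (x ord0 j - y ord0 j) ^+ 2) Num.sqrt); first exact: cont.
exact: sqrt_continuous.
Qed.

Lemma open_eball x d : open [set y | edist x y < d].
Proof.
by apply: (@open_comp _ _ (edist x) [set t | t < d]) => [y _|];
  [exact: edist_continuous|exact: open_lt].
Qed.

End EuclideanDistance.

(** * Enumeration of the words of a given length and sums over them *)

Section Words.
Variable m : nat.

Fixpoint words (k : nat) : seq (seq 'I_m) :=
  if k is k'.+1 then [seq i :: w | i <- enum 'I_m, w <- words k'] else [:: [::]].

Lemma mem_words k w : (w \in words k) = (size w == k).
Proof.
elim: k w => [|k IHk] [|i w] //=.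
- by apply/negbTE/allpairsP => -[[i v]] /= [].
- rewrite eqSS -IHk; apply/allpairsP/idP => [[[j v] /= [_ vk [_ ->]]]|wk] //.
  by exists (i, w); rewrite mem_enum.
Qed.

Lemma words_uniq k : uniq (words k).
Proof.
elim: k => //= k IHk; apply: allpairs_uniq => //; first exact: enum_uniq.
by move=> [i v] [j w] _ _ /= [-> ->].
Qed.

Lemma big_wordsS (R : nmodType) k (F : seq 'I_m -> R) :
  \sum_(w <- words k.+1) F w = \sum_i \sum_(w <- words k) F (i :: w).
Proof. by rewrite /= big_allpairs_dep big_enum. Qed.

Lemma big_wordsD (R : nmodType) a b (F : seq 'I_m -> R) :
  \sum_(w <- words (a + b)) F w =
  \sum_(u <- words a) \sum_(v <- words b) F (u ++ v).
Proof.
elim: a F => [|a IHa] F; first by rewrite big_seq1.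
by rewrite addSn !big_wordsS; apply: eq_bigr => i _; rewrite IHa.
Qed.

End Words.

(** * Real inequalities: monotonicity of powers, slack factors, geometric decay *)

Section RealFacts.
Variable R : realType.
Implicit Types (s d D x y : R).

Lemma powR_le_mono s x y : 0 < s -> 0 <= x -> x <= y -> x `^ s <= y `^ s.
Proof.
move=> s0 x0 xy.
by apply: (ge0_ler_powR (ltW s0)) => //; rewrite nnegrE// (le_trans x0).
Qed.

Lemma powR_npos_antimono s x y : s <= 0 -> 0 < x -> x <= y -> y `^ s <= x `^ s.
Proof.
move=> s0 x0 xy; have y0 := lt_le_trans x0 xy.
rewrite -[s]opprK !(powRN _ (- s)) lef_pV2 ?posrE ?powR_gt0//.
by apply: (ge0_ler_powR _ _ _ xy); rewrite ?nnegrE; lra.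
Qed.

Lemma mul_slack x y : 0 <= x -> x < y -> exists2 t, 1 < t & t * x < y.
Proof.
move=> x0 xy; have x1 : 0 < x + 1 by rewrite ltr_wpDl.
(* Dividing by [x + 1] instead of [x] covers the case [x = 0]. *)
have yx : 0 < (y - x) / (x + 1) by rewrite divr_gt0 ?subr_gt0.
exists (1 + (y - x) / (x + 1)); first by rewrite ltrDl.
have -> : (1 + (y - x) / (x + 1)) * x = y - (y - x) / (x + 1) by field; lra.
by rewrite ltrBlDr ltrDl.
Qed.

Lemma inf_ge0 (S : set R) : (forall t, S t -> 0 <= t) -> 0 <= inf S.
Proof.
move=> S0; have [->|/set0P Sn0] := eqVneq S set0; first by rewrite inf0.
exact: lb_le_inf.
Qed.

Lemma expr_small x y : 0 <= x < 1 -> 0 < y -> exists n, x ^+ n <= y.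
Proof.
move=> /andP[x0 x1] y0.
have /cvgrPdist_le/(_ _ y0)[N _ /(_ N (leqnn N))] : GRing.exp x @ \oo --> 0.
  by apply: cvg_expr; rewrite ger0_norm.
by rewrite /= sub0r normrN normrX ger0_norm// => ?; exists N.
Qed.

(** Mean value theorem: on [c, L] the derivative s x^(s-1) is at most s times [Qconst s L c], its
    extreme point being [L] for s >= 1 and [c] for s < 1. *)
Lemma powR_sub_le s d D c L t : 0 < s -> 0 < c -> c <= d -> 0 <= D -> D <= L ->
  0 <= t -> D <= d + t -> D `^ s <= d `^ s + s * t * Qconst s L c.
Proof.
move=> s0 c0 cd D0 DL t0 Ddt; have d0 := lt_le_trans c0 cd.
have Q0 : 0 <= Qconst s L c by rewrite /Qconst; case: ifP => _; exact: powR_ge0.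
have [Dd|dD] := leP D d.
  by rewrite ler_wpDr ?powR_le_mono// !mulr_ge0// ltW.
have drv x : x \in `]d, D[ -> is_derive x 1 (@powR R ^~ s) (s * x `^ (s - 1)).
  by rewrite in_itv /= => /andP[dx _]; apply: is_derive1_powR; lra.
have cont : {within `[d, D], continuous (@powR R ^~ s)}.
  apply: derivable_within_continuous => x; rewrite in_itv /= => /andP[dx _].
  by apply: derivable_powR; rewrite in_itv /= andbT; lra.
have [x] := MVT dD drv cont; rewrite in_itv /= => /andP[dx xD].
move/eqP; rewrite subr_eq => /eqP ->; rewrite addrC lerD2l -!mulrA.
rewrite ler_pM2l// mulrC ler_pM ?powR_ge0//; try lra.
rewrite /Qconst; case: ifP => s1.
  by apply: (ge0_ler_powR _ _ _); rewrite ?nnegrE; lra.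
by apply: powR_npos_antimono => //; lra.
Qed.

End RealFacts.

(** * Finite selection: maximisers on a list and a threshold common to a list *)

Lemma seq_argmax (T : eqType) (R : realDomainType) (g : T -> R) (P : pred T)
    (l : seq T) x0 : x0 \in l -> P x0 ->
  exists x, [/\ x \in l, P x & forall y, y \in l -> P y -> g y <= g x].
Proof.
elim: l x0 => // a l IHl x0 x0l Px0.
have [[x1 [x1l Px1]]|nol] := pselect (exists x1, x1 \in l /\ P x1).
  have [x [xl Px xmax]] := IHl _ x1l Px1.
  have [/andP[Pa gxa]|/negP nPa] := boolP (P a && (g x <= g a)).
    exists a; rewrite mem_head; split=> // y; rewrite inE => /predU1P[->//|yl Py].
    exact: le_trans (xmax y yl Py) gxa.
  exists x; rewrite inE xl orbT; split=> // y.
  rewrite inE => /predU1P[-> Pa|]; last exact: xmax.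
  by rewrite leNgt; apply/negP => /ltW ?; apply: nPa; rewrite Pa.
have ax0 : x0 = a.
  by move: x0l; rewrite inE => /predU1P[//|x0l]; case: nol; exists x0.
exists a; rewrite mem_head -{1}ax0; split=> // y; rewrite inE => /predU1P[->//|yl Py].
by case: nol; exists y.
Qed.

Lemma eventually_all (T : eqType) (l : seq T) (P : T -> nat -> Prop) :
  (forall a, a \in l -> exists N0, forall N, (N0 <= N)%N -> P a N) ->
  exists N, forall a, a \in l -> P a N.
Proof.
move=> Pl; suff [N PN] : exists N0, forall a, a \in l -> forall N, (N0 <= N)%N -> P a N.
  by exists N => a al; exact: PN.
elim: l Pl => [|a l IHl] Pl; first by exists 0%N.
have [|N1 PN1] := IHl; first by move=> b bl; apply: Pl; rewrite inE bl orbT.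
have [N2 PN2] := Pl a (mem_head _ _).
exists (maxn N1 N2) => b; rewrite inE => /predU1P[->|bl] N.
  by rewrite geq_max => /andP[_]; exact: PN2.
by rewrite geq_max => /andP[+ _]; exact: PN1.
Qed.


(** * Ratios and masses of words *)

Section SelfSimilarSet.
Variables (R : realType) (n m : nat).
Variables (f : 'I_m -> 'rV[R]_n -> 'rV[R]_n) (r : 'I_m -> R).
Variables (E : set 'rV[R]_n) (s : R).
Hypothesis m_ge2 : (2 <= m)%N.
Hypothesis f_sim : forall i, contracting_similitude (f i) (r i).
Hypothesis E_attr : is_attractor f E.
Hypothesis E_ssc : strong_separation f E.
Hypothesis sum_rs1 : \sum_i r i `^ s = 1.
Hypothesis diam_gt0 : 0 < diam E.
Hypothesis sep_gt0 : 0 < separation f E.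
Implicit Types (x y z : 'rV[R]_n) (i j : 'I_m) (u v w : seq 'I_m).

Lemma ratio_gt0 i : 0 < r i. Proof. by have [/andP[]] := f_sim i. Qed.

Lemma ratio_lt1 i : r i < 1. Proof. by have [/andP[]] := f_sim i. Qed.

Lemma ratio_le_rmax i : r i <= rmax r.
Proof. exact: le_bigmax. Qed.

Lemma rmin_le_ratio i : rmin r <= r i.
Proof. exact: bigmin_le. Qed.

Lemma rmax_ge0 : 0 <= rmax r.
Proof. exact: bigmax_ge_id. Qed.

Lemma rmax_lt1 : rmax r < 1.
Proof. by apply: bigmax_lt => // i _; exact: ratio_lt1. Qed.

Lemma rmin_gt0 : 0 < rmin r.
Proof. by apply: lt_bigmin => // i _; exact: ratio_gt0. Qed.

Lemma rmin_le1 : rmin r <= 1.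
Proof. exact: bigmin_le_id. Qed.

(** For s <= 0 every r_i^s would be at least 1, and the sum at least m >= 2. *)
Lemma dim_gt0 : 0 < s.
Proof.
rewrite ltNge; apply/negP => s0.
suff : \sum_(i < m) 1 <= \sum_i r i `^ s :> R.
  by rewrite sum_rs1 sumr_const card_ord lern1 leqNgt m_ge2.
apply: ler_sum => i _; apply: (@le_trans _ _ (1 `^ s)); first by rewrite powR1.
by apply: powR_npos_antimono; rewrite ?ratio_gt0// ltW// ratio_lt1.
Qed.

Definition cylinder_mass w : R := word_ratio r w `^ s.

Lemma word_ratio_nil : word_ratio r [::] = 1.
Proof. exact: big_nil. Qed.

Lemma word_ratio_cons i w : word_ratio r (i :: w) = r i * word_ratio r w.
Proof. exact: big_cons. Qed.

Lemma word_ratio_cat u v : word_ratio r (u ++ v) = word_ratio r u * word_ratio r v.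
Proof. exact: big_cat. Qed.

Lemma word_ratio_gt0 w : 0 < word_ratio r w.
Proof. by apply: prodr_gt0 => i _; exact: ratio_gt0. Qed.

Lemma word_ratio_le w : word_ratio r w <= rmax r ^+ size w.
Proof.
elim: w => [|i w IHw]; first by rewrite word_ratio_nil.
rewrite word_ratio_cons exprS.
by apply: ler_pM => //; rewrite ?ratio_le_rmax ?ltW// ?ratio_gt0 ?word_ratio_gt0.
Qed.

Lemma word_ratio_ge w : rmin r ^+ size w <= word_ratio r w.
Proof.
elim: w => [|i w IHw]; first by rewrite word_ratio_nil.
rewrite word_ratio_cons exprS.
by apply: ler_pM => //; rewrite ?rmin_le_ratio ?exprn_ge0// ltW// rmin_gt0.
Qed.

Lemma cylinder_mass_gt0 w : 0 < cylinder_mass w.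
Proof. exact/powR_gt0/word_ratio_gt0. Qed.

Lemma cylinder_mass_nil : cylinder_mass [::] = 1.
Proof. by rewrite /cylinder_mass word_ratio_nil powR1. Qed.

Lemma cylinder_mass_cat u v :
  cylinder_mass (u ++ v) = cylinder_mass u * cylinder_mass v.
Proof.
by rewrite /cylinder_mass word_ratio_cat powRM// ltW// word_ratio_gt0.
Qed.

Lemma cylinder_mass_cons i w : cylinder_mass (i :: w) = r i `^ s * cylinder_mass w.
Proof.
by rewrite /cylinder_mass word_ratio_cons powRM// ltW// ?ratio_gt0 ?word_ratio_gt0.
Qed.

Lemma sum_cylinder_mass k : \sum_(w <- words m k) cylinder_mass w = 1.
Proof.
elim: k => [|k IHk]; first by rewrite big_seq1 cylinder_mass_nil.
rewrite big_wordsS -[RHS]sum_rs1; apply: eq_bigr => i _.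
under eq_bigr => w _ do rewrite cylinder_mass_cons.
by rewrite -mulr_sumr IHk mulr1.
Qed.

Lemma cylinder_mass_le1 w : cylinder_mass w <= 1.
Proof.
rewrite -(sum_cylinder_mass (size w)) (bigD1_seq w) ?words_uniq ?mem_words//=.
by rewrite ler_wpDr// sumr_ge0// => v _; exact/ltW/cylinder_mass_gt0.
Qed.

Lemma cylinder_mass_ge q w : (size w <= q)%N ->
  rmin r `^ (q%:R * s) <= cylinder_mass w.
Proof.
move=> wq; rewrite /cylinder_mass powRrM powR_mulrn; last exact/ltW/rmin_gt0.
apply: powR_le_mono; [exact: dim_gt0|exact/ltW/exprn_gt0/rmin_gt0|].
apply: le_trans (word_ratio_ge w).
by apply: ler_wiXn2l => //; [exact/ltW/rmin_gt0|exact: rmin_le1].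
Qed.

(** If q <= k, all extensions of the first [q] letters of [u] are counted, and their masses add up
    to the mass of that prefix. If k < q, the word [u] alone is short enough. *)
Lemma sum_cylinder_mass_ge q k u (P : pred (seq 'I_m)) : size u = k -> P u ->
  ((q <= k)%N -> forall v, size v = k -> take q v = take q u -> P v) ->
  rmin r `^ (q%:R * s) <= \sum_(v <- words m k | P v) cylinder_mass v.
Proof.
move=> uk Pu Pq; rewrite big_mkcond /=.
have ge0 v : 0 <= (if P v then cylinder_mass v else 0).
  by case: ifP => // _; exact/ltW/cylinder_mass_gt0.
have [qk|kq] := leqP q k; last first.
  rewrite (bigD1_seq u) ?words_uniq ?mem_words ?uk//= Pu.
  by rewrite ler_wpDr ?sumr_ge0// cylinder_mass_ge// uk ltnW.
rewrite -(subnKC qk) big_wordsD.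
have tu : size (take q u) = q by rewrite size_takel// uk.
rewrite (bigD1_seq (take q u)) ?words_uniq ?mem_words ?tu//=.
apply: (@le_trans _ _ (\sum_(v <- words m (k - q)) cylinder_mass (take q u ++ v))).
  under eq_bigr => v _ do rewrite cylinder_mass_cat.
  by rewrite -mulr_sumr sum_cylinder_mass mulr1 cylinder_mass_ge// tu.
rewrite ler_wpDr//; first by apply: sumr_ge0 => a _; apply: sumr_ge0.
rewrite big_seq [leRHS]big_seq; apply: ler_sum => v; rewrite mem_words => /eqP vk.
by rewrite Pq// ?size_cat ?tu ?vk ?subnKC// take_size_cat.
Qed.

(** * Geometry of cylinders: nesting, disjointness, diameters and gaps *)

Lemma word_map_cat u v x : word_map f (u ++ v) x = word_map f u (word_map f v x).
Proof. by elim: u => //= i u ->. Qed.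

Lemma edist_map i x y : edist (f i x) (f i y) = r i * edist x y.
Proof. by have [_] := f_sim i. Qed.

Lemma edist_word_map w x y :
  edist (word_map f w x) (word_map f w y) = word_ratio r w * edist x y.
Proof.
elim: w => [|i w IHw] /=; first by rewrite word_ratio_nil mul1r.
by rewrite edist_map IHw word_ratio_cons mulrA.
Qed.

Lemma map_inj i : injective (f i).
Proof.
move=> x y fxy; apply: edist_eq0; rewrite -(pmulr_rle0 _ (ratio_gt0 i)).
by rewrite -edist_map fxy edistxx.
Qed.

Lemma attractor_map i x : E x -> E (f i x).
Proof. by move=> Ex; have [_ _ ->] := E_attr; exists i => //; exists x. Qed.

Lemma attractor_map_inv x : E x -> exists i y, E y /\ x = f i y.
Proof.
by have [_ _ EE] := E_attr; rewrite {1}EE => -[i _ [y Ey <-]]; exists i, y.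
Qed.

Lemma attractor_map_disj i j x y : E x -> E y -> f i x = f j y -> i = j.
Proof.
move=> Ex Ey fxy; apply/eqP/negP => /negP ij.
have : (f i @` E `&` f j @` E) (f i x) by split; [exists x|exists y].
by rewrite E_ssc.
Qed.

Definition cylinder w : set 'rV[R]_n := word_map f w @` E.

Lemma cylinder_cons i w x : cylinder w x -> cylinder (i :: w) (f i x).
Proof. by case=> y Ey <-; exists y. Qed.

Lemma cylinder_cat u v x : cylinder (u ++ v) x <->
  exists2 y, cylinder v y & x = word_map f u y.
Proof.
split=> [[y Ey <-]|[_ [y Ey <-] ->]].
  by exists (word_map f v y); [exists y|rewrite word_map_cat].
by exists y => //; rewrite word_map_cat.
Qed.

Lemma cylinder_attractor w x : cylinder w x -> E x.
Proof. by case=> y Ey <-; elim: w => //= i w IHw; exact: attractor_map. Qed.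

Lemma cylinder_prefix u v x : cylinder (u ++ v) x -> cylinder u x.
Proof. by move/cylinder_cat=> [y /cylinder_attractor Ey ->]; exists y. Qed.

Lemma attractor_cylinder k x : E x -> exists2 w, size w = k & cylinder w x.
Proof.
elim: k x => [|k IHk] x Ex; first by exists [::] => //; exists x.
have [i [y [/IHk[w wk wy] ->]]] := attractor_map_inv Ex.
by exists (i :: w) => /=; [rewrite wk|exact: cylinder_cons].
Qed.

Lemma cylinder_consE i w x : cylinder (i :: w) x ->
  exists2 y, cylinder w y & x = f i y.
Proof. by case=> y Ey <-; exists (word_map f w y) => //; exists y. Qed.

(** Strong separation identifies the first letters, and injectivity of the similitudes strips them
    off. *)
Lemma cylinder_disj u v x : size u = size v -> cylinder u x -> cylinder v x ->
  u = v.
Proof.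
elim: u v x => [|i u IHu] [|j v] x //= [uv].
move=> /cylinder_consE[y uy ->] /cylinder_consE[z vz fyz].
have ij := attractor_map_disj (cylinder_attractor uy) (cylinder_attractor vz) fyz.
by move: fyz; rewrite -ij => /map_inj yz; rewrite (IHu v y)// yz.
Qed.

(* The supremum defining [diam E] is positive, hence not the default value of
   [sup] on unbounded sets. *)
Lemma edist_le_diam x y : E x -> E y -> edist x y <= diam E.
Proof.
move=> Ex Ey; have [hs|/sup_out d0] := pselect (has_sup
    [set t | exists x y, [/\ E x, E y & t = edist x y]]).
  by apply: (sup_upper_bound hs); exists x, y.
by move: diam_gt0; rewrite /diam d0 ltxx.
Qed.

Lemma separation_le i j x y : E x -> E y -> i != j ->
  separation f E <= edist (f i x) (f j y).
Proof.
move=> Ex Ey ij; apply: (@le_trans _ _ (setdist (f i @` E) (f j @` E))).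
  (* The lower bound 0 is needed for an infimum to lie below its elements. *)
  apply: ge_inf; last by exists i, j.
  exists 0 => _ [a [b [_ ->]]]; apply: inf_ge0 => _ [u [v [_ _ ->]]].
  exact: edist_ge0.
apply: ge_inf; first by exists 0 => _ [u [v [_ _ ->]]]; exact: edist_ge0.
by exists (f i x), (f j y); split.
Qed.

Lemma edist_le_cylinder w x y : cylinder w x -> cylinder w y ->
  edist x y <= diam E * rmax r ^+ size w.
Proof.
move=> [a Ea <-] [b Eb <-]; rewrite edist_word_map mulrC.
by apply: ler_pM; rewrite ?edist_ge0 ?edist_le_diam ?word_ratio_le// ltW// word_ratio_gt0.
Qed.

(** * Fixed points of the similitudes and the points of A_k *)

Lemma fixed_point i : exists2 p, f i p = p & E p.
Proof.
have [[e Ee] cptE _] := E_attr.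
(* By compactness the orbit of a point of E has a cluster point p in E. Consecutive orbit points
   become arbitrarily close, so |f_i(p) - p| is bounded by three distances of size at most eps/3. *)
pose orb k := iter k (f i) e.
have Eorb k : E (orb k) by elim: k => //= k; exact: attractor_map.
have step k : edist (orb k) (orb k.+1) <= r i ^+ k * diam E.
  elim: k => [|k IHk].
    by rewrite expr0 mul1r; exact: edist_le_diam (Eorb 0%N) (Eorb 1%N).
  by rewrite [leLHS]edist_map exprS -mulrA ler_pM2l ?ratio_gt0 ?IHk.
have orbE : (orb @ \oo) E by exists 0%N => // k _; exact: Eorb.
have [p [Ep clp]] := cptE (orb @ \oo) _ orbE.
exists p => //; apply: edist_eq0; apply/ler_addgt0Pl => eps eps0; rewrite addr0.
have eps3 : 0 < eps / 3 by rewrite divr_gt0.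
have [N rN] : exists N, r i ^+ N * diam E <= eps / 3.
  have [] := @expr_small _ (r i) (eps / 3 / diam E); rewrite ?divr_gt0//.
    by rewrite ltW ?ratio_gt0 ?ratio_lt1.
  by move=> N; rewrite ler_pdivlMr//; exists N.
have nbp : nbhs p [set y | edist p y < eps / 3].
  by apply: open_nbhs_nbhs; split; [exact: open_eball|rewrite /= edistxx].
have tail : (orb @ \oo) [set orb k | k in [set k | (N <= k)%N]].
  by exists N => // k /= Nk; exists k.
have [_ [[k /= Nk <-] pk]] := clp _ _ tail nbp.
have rk : edist (orb k) (orb k.+1) <= eps / 3.
  apply: le_trans (step k) (le_trans _ rN); rewrite ler_pM2r//.
  by apply: ler_wiXn2l => //; rewrite ltW ?ratio_gt0 ?ratio_lt1.
have := edist_triangle (f i p) (orb k.+1) p.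
have := edist_triangle (orb k.+1) (orb k) p.
have fk : edist (f i p) (orb k.+1) <= edist p (orb k).
  by rewrite [leLHS]edist_map ler_piMl ?edist_ge0// ltW ?ratio_lt1.
rewrite (edistC (orb k.+1) (orb k)) (edistC (orb k) p); rewrite /= in pk *; lra.
Qed.

Definition fixpt i : 'rV[R]_n := s2val (cid2 (fixed_point i)).

Lemma fixptE i x : f i x = x <-> x = fixpt i.
Proof.
have fp : f i (fixpt i) = fixpt i := s2valP (cid2 (fixed_point i)).
split=> [fx|->//]; apply: edist_eq0; rewrite leNgt; apply/negP => d0.
have := edist_map i x (fixpt i); rewrite fx fp => /eqP.
by rewrite -subr_eq0 -{1}[edist _ _]mul1r -mulrBl mulf_eq0 subr_eq0 !gt_eqF ?ratio_lt1.
Qed.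

(** The last letter fixes its own fixed point, so this is that point moved by the preceding letters,
    as in the recursion for A_k; written with the full word, it is visibly in E_w. The value at the
    empty word is a dummy. *)
Definition cylinder_pt w : 'rV[R]_n :=
  if w is i :: w' then word_map f w (fixpt (last i w')) else 0.

Lemma cylinder_pt_in w : w != [::] -> cylinder w (cylinder_pt w).
Proof.
case: w => // i w _; exists (fixpt (last i w)) => //.
exact: (s2valP' (cid2 (fixed_point (last i w)))).
Qed.

Lemma approx_ptsP k x : (0 < k)%N ->
  approx_pts f k x <-> exists2 w, size w = k & x = cylinder_pt w.
Proof.
case: k => // k _; elim: k x => [|k IHk] x.
  split=> [[i /fixptE ->]|[[|i [|//]] //= _ ->]].
    by exists [:: i] => //=; apply/esym/fixptE.
  by exists i; congr f; apply/fixptE.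
split=> [[i _ [y /IHk[[//|j w] wk ->] <-]]|[[//|i [//|j w]] [wk] ->]].
  by exists [:: i, j & w] => //; rewrite -wk.
exists i => //; exists (cylinder_pt (j :: w)) => //; apply/IHk.
by exists (j :: w) => //=; rewrite wk.
Qed.

(** * Level k: the discrete measure, displacement of points and the change of radius *)

Section Level.
Variable k : nat.
Hypothesis k_gt0 : (0 < k)%N.

Lemma level_pt_in w : size w = k -> cylinder w (cylinder_pt w).
Proof. by move=> wk; apply: cylinder_pt_in; rewrite -size_eq0 wk -lt0n. Qed.

Lemma word_of_cylinder_pt w : size w = k -> word_of f E k (cylinder_pt w) = w.
Proof.
move=> wk; rewrite /word_of; have := level_pt_in wk.
case: xgetP => [v -> [vk vw] wc|/(_ w)[]]; last by split=> //; exact: level_pt_in.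
by apply: (cylinder_disj _ vw wc); rewrite vk wk.
Qed.

(** Cylinders of equal length are disjoint, so [cylinder_pt] is injective on [words m k] and the sum
    over points becomes a sum over words. *)
Lemma approx_measureE (B : set 'rV[R]_n) : approx_measure f r E s k B =
  \sum_(w <- words m k | cylinder_pt w \in B) cylinder_mass w.
Proof.
have inj : {in words m k &, injective cylinder_pt}.
  move=> v w; rewrite !mem_words => /eqP vk /eqP wk vw.
  by rewrite -(word_of_cylinder_pt vk) vw word_of_cylinder_pt.
have ptsE : approx_pts f k = [set` [seq cylinder_pt w | w <- words m k]].
  apply/seteqP; split=> x /=.
    move/(approx_ptsP _ k_gt0) => [w wk ->].
    by apply: map_f; rewrite mem_words wk.
  move/mapP=> [w]; rewrite mem_words => /eqP wk ->.
  by apply/approx_ptsP => //; exists w.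
rewrite /approx_measure ptsE -fsbig_seq ?map_inj_in_uniq ?words_uniq// big_map.
rewrite [RHS]big_mkcond /= big_seq [RHS]big_seq.
apply: eq_bigr => w; rewrite mem_words => /eqP wk.
rewrite word_of_cylinder_pt// indicE.
by case: (_ \in _); rewrite ?mulr1 ?mulr0.
Qed.

Lemma approx_measure_cballE u d : size u = k ->
  approx_measure f r E s k (cball (cylinder_pt u) d) =
  \sum_(w <- words m k | edist (cylinder_pt u) (cylinder_pt w) <= d)
    cylinder_mass w.
Proof.
move=> _; rewrite approx_measureE; apply: eq_bigl => w.
by apply/idP/idP; rewrite inE.
Qed.

Definition level_radius : R := diam E * rmax r ^+ k.

Lemma edist_le_level u x y : size u = k -> cylinder u x -> cylinder u y ->
  edist x y <= level_radius.
Proof. by move=> uk ux uy; rewrite /level_radius -uk; exact: edist_le_cylinder. Qed.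

Lemma edist_level_pts u v x y : size u = k -> size v = k ->
  cylinder u x -> cylinder v y ->
  `|edist x y - edist (cylinder_pt u) (cylinder_pt v)| <= 2 * level_radius.
Proof.
move=> uk vk ux vy.
have := edist_le_level uk ux (level_pt_in uk).
have := edist_le_level vk vy (level_pt_in vk).
move: (cylinder_pt u) (cylinder_pt v) => a b.
have := edist_triangle x a y; have := edist_triangle a b y.
have := edist_triangle a x b; have := edist_triangle x y b.
rewrite (edistC b y) (edistC a x) ler_norml; lra.
Qed.

Section Separated.
Variable q : nat.
Hypothesis q_sep : diam E * rmax r ^+ q <= separation f E.

(** Words agreeing with [u] in the first [q] letters share a cylinder of diameter at most R r_max^q
    <= c <= d, so [P] holds for all of them. *)
Lemma ball_mass_ge u (P : pred (seq 'I_m)) d : size u = k -> P u ->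
    separation f E <= d ->
    (forall v, size v = k ->
       (forall x y, cylinder u x -> cylinder v y -> edist x y <= d) -> P v) ->
  rmin r `^ (q%:R * s) <= \sum_(v <- words m k | P v) cylinder_mass v.
Proof.
move=> uk Pu cd Pd; apply: sum_cylinder_mass_ge (uk) (Pu) _ => qk v vk tvu.
apply: Pd => // x y ux vy; apply: le_trans cd; apply: le_trans q_sep.
have tu : size (take q u) = q by rewrite size_takel// uk.
rewrite -[X in _ ^+ X]tu; apply: edist_le_cylinder.
  by apply: (@cylinder_prefix _ (drop q u)); rewrite cat_take_drop.
by apply: (@cylinder_prefix _ (drop q v)); rewrite -tvu cat_take_drop.
Qed.

(** [powR_sub_le] with t = 2 R r_max^k: multiplied by 2^s, the increment s t Q becomes s 2^(s+1) R Q
    r_max^k, which is eps_k r_min^(qs). *)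
Lemma enlarge_radius d D : separation f E <= d -> 0 <= D -> D <= diam E ->
    D <= d + 2 * level_radius ->
  (2 * D) `^ s <= (2 * d) `^ s +
    error_bound s (diam E) (separation f E) (rmin r) (rmax r) q k
      * rmin r `^ (q%:R * s).
Proof.
move=> cd D0 DR Dd; have d0 := lt_le_trans sep_gt0 cd.
have lr0 : 0 <= 2 * level_radius.
  by rewrite mulr_ge0// mulr_ge0 ?exprn_ge0 ?rmax_ge0// ltW.
have := powR_sub_le dim_gt0 sep_gt0 cd D0 DR lr0 Dd.
rewrite !powRM ?(ltW d0)// /error_bound powRD ?pnatr_eq0 ?implybT//.
rewrite powRr1// => DdQ; rewrite [_ / _ * _]mulrAC divfK; last first.
  by rewrite gt_eqF// powR_gt0// rmin_gt0.
have := powR_gt0 s (ltr0n R 2) => p2.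
rewrite -(ler_pM2l p2) in DdQ; apply: le_trans DdQ _.
by rewrite mulrDr lerD2l /level_radius le_eqVlt; apply/orP; left; apply/eqP; ring.
Qed.

End Separated.

End Level.

(** * Finite covers of the part of F in A, with centres in F and cost at most t *)

Definition finitely_covered (F A : set 'rV[R]_n) (delta t : R) : Prop :=
  exists C : seq ('rV[R]_n * R),
    [/\ forall b, b \in C -> [/\ F b.1, 0 < b.2 & 2 * b.2 <= delta],
        forall x, F x -> A x -> exists2 b, b \in C & cball b.1 b.2 x &
        \sum_(b <- C) (2 * b.2) `^ s <= t].

Section FiniteCovers.
Variables (F : set 'rV[R]_n) (delta : R).

Lemma finitely_covered_sub A B t t' : finitely_covered F B delta t ->
  F `&` A `<=` B -> t <= t' -> finitely_covered F A delta t'.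
Proof.
move=> [C [Cok Ccov Ct]] AB tt'; exists C; split=> //; last exact: le_trans tt'.
by move=> x Fx Ax; apply: Ccov => //; exact: AB.
Qed.

Lemma finitely_covered0 A : F `&` A `<=` set0 -> finitely_covered F A delta 0.
Proof.
move=> FA0; exists [::]; split=> //; last by rewrite big_nil.
by move=> x Fx Ax; case: (FA0 x).
Qed.

Lemma finitely_coveredU A B a b : finitely_covered F A delta a ->
  finitely_covered F B delta b -> finitely_covered F (A `|` B) delta (a + b).
Proof.
move=> [C [Cok Ccov Ca]] [D [Dok Dcov Db]]; exists (C ++ D); split=> [p|x Fx|].
- by rewrite mem_cat => /orP[/Cok|/Dok].
- move=> [/(Ccov x Fx)|/(Dcov x Fx)] [p pC px]; exists p => //;
  by rewrite mem_cat pC ?orbT.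
- by rewrite big_cat lerD.
Qed.

Lemma finitely_covered_ball y d : F y -> 0 < d -> 2 * d <= delta ->
  finitely_covered F (cball y d) delta ((2 * d) `^ s).
Proof.
move=> Fy d0 dd; exists [:: (y, d)]; split=> [p|x _ xd|].
- by rewrite inE => /eqP ->.
- by exists (y, d); rewrite ?mem_head.
- by rewrite big_seq1.
Qed.

Lemma finitely_covered_bigU (T : eqType) (l : seq T) (P : pred T)
    (A : T -> set 'rV[R]_n) (t : T -> R) :
  (forall a, a \in l -> P a -> finitely_covered F (A a) delta (t a)) ->
  finitely_covered F [set x | exists a, [/\ a \in l, P a & A a x]] delta
    (\sum_(a <- l | P a) t a).
Proof.
elim: l => [|a l IHl] lcov.
  by rewrite big_nil; apply: finitely_covered0 => x [_ /= [b []]].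
have lcov' b : b \in l -> P b -> finitely_covered F (A b) delta (t b).
  by move=> bl; apply: lcov; rewrite inE bl orbT.
rewrite big_cons; case: ifP => Pa.
  apply: finitely_covered_sub (lexx _).
    by apply: finitely_coveredU (IHl lcov'); apply: lcov Pa; exact: mem_head.
  move=> x [_ /= [b []]]; rewrite inE => /predU1P[-> _|bl Pb] Ax; first by left.
  by right; exists b.
apply: finitely_covered_sub (IHl lcov') _ (lexx _).
move=> x [_ /= [b []]]; rewrite inE => /predU1P[->|bl] Pb Ax; first by rewrite Pa in Pb.
by exists b.
Qed.

Lemma finitely_covered_premeasure t : finitely_covered F F delta t ->
  (centered_premeasure_at s F delta <= t%:E)%E.
Proof.
move=> [C [Cok Ccov Ct]]; pose b (l : nat) := nth (0, 0) C l.
have le_esum : (centered_premeasure_at s F delta <=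
    \esum_(l in `I_(size C)) ((2 * (b l).2) `^ s)%:E)%E.
  apply: ereal_inf_lbound; exists `I_(size C), (fun l => (b l).1), (fun l => (b l).2).
  split=> //; split=> [i /= iC|x Fx]; first by apply: Cok; exact: mem_nth.
  have [p pC px] := Ccov x Fx Fx.
  by exists (index p C); rewrite /= ?index_mem// /b nth_index.
apply: le_trans le_esum _.
rewrite esum_fset//; last by move=> i _; rewrite lee_fin powR_ge0.
rewrite -fsbig_ord sumEFin lee_fin; apply: le_trans Ct.
by rewrite [leRHS](big_nth (0, 0)) big_mkord.
Qed.

End FiniteCovers.

(** * Existence of the limit defining the premeasure *)

Lemma premeasure_at_nonincreasing (F : set 'rV[R]_n) :
  nonincreasing_fun (centered_premeasure_at s F).
Proof.
move=> d1 d2 d12; apply: ereal_inf_le_tmp => _ [I [x [d [[Iok Icov] ->]]]].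
exists I, x, d; split=> //; split=> // i /Iok[Fx d0 dd].
by split=> //; exact: le_trans d12.
Qed.

Lemma premeasure_at_is_cvg (F : set 'rV[R]_n) :
  cvg (centered_premeasure_at s F delta @[delta --> 0^'+]).
Proof.
apply: nonincreasing_at_right_is_cvge; apply: nearW => b x y _ _.
exact: premeasure_at_nonincreasing.
Qed.

(** * Upper bound for C^s(E) by iterated covering of cylinders *)

Section UpperBound.
Variables (k : nat) (u : seq 'I_m) (G : pred (seq 'I_m)) (D : R).
Hypotheses (uk : size u = k) (Gu : G u) (D_gt0 : 0 < D) (D_le : D <= diam E).
Hypothesis G_near : forall v x y, size v = k -> G v ->
  cylinder u x -> cylinder v y -> edist x y <= D.

Local Notation selected_mass := (\sum_(v <- words m k | G v) cylinder_mass v).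
Local Notation H := ((2 * D) `^ s / selected_mass).

Lemma selected_mass_ge : cylinder_mass u <= selected_mass.
Proof.
rewrite big_mkcond (bigD1_seq u) ?words_uniq ?mem_words ?uk//= Gu.
rewrite ler_wpDr// sumr_ge0// => v _; case: ifP => // _.
exact/ltW/cylinder_mass_gt0.
Qed.

Lemma selected_mass_gt0 : 0 < selected_mass.
Proof. exact: lt_le_trans (cylinder_mass_gt0 u) selected_mass_ge. Qed.

Lemma sum_cylinder_mass_notin (P : pred (seq 'I_m)) :
  \sum_(v <- words m k | ~~ P v) cylinder_mass v =
  1 - \sum_(v <- words m k | P v) cylinder_mass v.
Proof.
by have := sum_cylinder_mass k; rewrite (bigID P) /= => <-; rewrite [RHS]addrC addKr.
Qed.

(* [l] counts the steps of the covering procedure: each step multiplies the mass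
   left to be covered by at most 1 - r_u^s. *)
Lemma finitely_covered_cylinder (F : set 'rV[R]_n) delta (l : nat) w :
  2 * (word_ratio r w * diam E) <= delta ->
  finitely_covered F (cylinder w) delta
    (cylinder_mass w * (H + (2 * diam E) `^ s * (1 - cylinder_mass u) ^+ l)).
Proof.
have H0 : 0 <= H by rewrite divr_ge0 ?powR_ge0// ltW// selected_mass_gt0.
have HG : H * selected_mass = (2 * D) `^ s by rewrite divfK// gt_eqF// selected_mass_gt0.
move: H H0 HG => h h0 hG.
have u1 : 0 <= 1 - cylinder_mass u by rewrite subr_ge0 cylinder_mass_le1.
have ratio_ge0 v : 0 <= word_ratio r v by exact/ltW/word_ratio_gt0.
have mass_ge0 v : 0 <= cylinder_mass v by exact/ltW/cylinder_mass_gt0.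
elim: l w => [|l IHl] w wd.
  (* No step left: if F meets E_w, one ball of radius r_w R centred there covers E_w at the cost
     r_w^s (2R)^s. *)
  have [[y [Fy wy]]|FE0] := pselect (exists y, F y /\ cylinder w y); last first.
    have cov0 : finitely_covered F (cylinder w) delta 0.
      by apply: finitely_covered0 => x [Fx wx]; apply: FE0; exists x.
    apply: finitely_covered_sub cov0 _ _; first by move=> x [].
    by rewrite mulr_ge0// addr_ge0// mulr_ge0 ?powR_ge0 ?exprn_ge0.
  have := finitely_covered_ball Fy _ wd.
  rewrite mulr_gt0 ?word_ratio_gt0// => /(_ isT) cov.
  apply: finitely_covered_sub cov _ _.
    move=> _ [_ [x Ex <-]]; case: wy => [z Ez <-].
    by rewrite /cball /= edist_word_map ler_pM2l ?word_ratio_gt0// edist_le_diam.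
  rewrite expr0 mulr1 mulrCA [leLHS]powRM ?mulr_ge0 ?(ltW diam_gt0)//.
  by rewrite -/(cylinder_mass w) ler_wpM2l// lerDr.
set c := h + _ * _ in IHl *.
have c0 : 0 <= c by rewrite addr_ge0// mulr_ge0 ?powR_ge0 ?exprn_ge0.
(* The cylinders E_wv with v outside [P] are left to the remaining [l] steps. *)
have sub P : finitely_covered F
    [set x | exists v, [/\ v \in words m k, ~~ P v & cylinder (w ++ v) x]] delta
    (cylinder_mass w * (1 - \sum_(v <- words m k | P v) cylinder_mass v) *
      (h + (2 * diam E) `^ s * (1 - cylinder_mass u) ^+ l)).
  rewrite -sum_cylinder_mass_notin mulr_sumr mulr_suml.
  under eq_bigr => v _ do rewrite -cylinder_mass_cat.
  apply: finitely_covered_bigU => v _ _; apply: IHl; apply: le_trans wd.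
  rewrite ler_pM2l// ler_pM2r// word_ratio_cat ler_piMr//.
  rewrite (le_trans (word_ratio_le v))// exprn_ile1 ?rmax_ge0//.
  exact/ltW/rmax_lt1.
have split_cyl x : cylinder w x ->
    exists2 v, v \in words m k & cylinder (w ++ v) x.
  move=> [y Ey <-]; have [v vk vy] := attractor_cylinder k Ey.
  by exists v; [rewrite mem_words vk|apply/cylinder_cat; exists y].
have [[y [Fy wuy]]|FE0] := pselect (exists y, F y /\ cylinder (w ++ u) y).
  have rD : 0 < word_ratio r w * D by rewrite mulr_gt0// word_ratio_gt0.
  have rDd : 2 * (word_ratio r w * D) <= delta.
    by apply: le_trans wd; rewrite ler_pM2l// ler_pM2l// word_ratio_gt0.
  apply: finitely_covered_sub
    (finitely_coveredU (finitely_covered_ball Fy rD rDd) (sub G)) _ _.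
    move=> x [Fx /split_cyl[v vk wvx]]; have [Gv|nGv] := boolP (G v); last first.
      by right; exists v.
    left; move: wuy wvx => /cylinder_cat[a ua ->] /cylinder_cat[b vb ->].
    rewrite /cball /= edist_word_map ler_pM2l ?word_ratio_gt0//.
    by apply: (G_near _ Gv ua vb); apply/eqP; rewrite -mem_words.
  have -> : (2 * (word_ratio r w * D)) `^ s = cylinder_mass w * (h * selected_mass).
    by rewrite mulrCA powRM ?mulr_ge0 ?(ltW D_gt0)// hG.
  rewrite -mulrA -mulrDr ler_pM2l ?cylinder_mass_gt0//.
  (* With M the mass of [G] and X the remainder term, h M + (1 - M)(h + X) = h + (1 - M) X, and M is
     at least the mass of [u]. *)
  rewrite [leLHS](_ : _ = h + (1 - selected_mass) *
    ((2 * diam E) `^ s * (1 - cylinder_mass u) ^+ l)); last ring.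
  rewrite lerD2l exprS [leRHS]mulrCA ler_wpM2r ?lerD2l ?lerN2 ?selected_mass_ge//.
  by rewrite mulr_ge0 ?powR_ge0 ?exprn_ge0.
(* F misses E_wu: dropping [u] alone leaves the fraction 1 - r_u^s of the mass. *)
apply: finitely_covered_sub (sub (pred1 u)) _ _.
  move=> x [Fx /split_cyl[v vk wvx]]; exists v; split=> //=.
  by apply/eqP => vu; apply: FE0; exists x; rewrite -vu.
rewrite big_mkcond (bigD1_seq u) ?words_uniq ?mem_words ?uk//= eqxx.
rewrite big1 ?addr0 => [|v /negbTE ->//].
rewrite -mulrA ler_pM2l ?cylinder_mass_gt0// mulrDr exprS [X in _ + X <= _]mulrCA lerD//.
by rewrite ler_piMl// lerBlDr lerDl ltW ?cylinder_mass_gt0.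
Qed.

(** Two depths are chosen: [L] makes the starting cylinders small enough for [delta], and [l] makes
    the remainder term at most [eps]. The masses at level [L] add up to 1. *)
Lemma centered_hausdorff_le : (centered_hausdorff s E <= H%:E)%E.
Proof.
apply: ge_ereal_sup => _ [F FE <-]; apply: lime_le; first exact: premeasure_at_is_cvg.
near=> delta; have delta0 : 0 < delta by [].
have [L rL] : exists L, rmax r ^+ L <= delta / (2 * diam E).
  by apply: expr_small; rewrite ?rmax_ge0 ?rmax_lt1 ?divr_gt0 ?mulr_gt0.
apply/lee_addgt0Pr => eps eps0.
have B0 : 0 < (2 * diam E) `^ s by rewrite powR_gt0 ?mulr_gt0.
have [l ul] : exists l, (1 - cylinder_mass u) ^+ l <= eps / (2 * diam E) `^ s.
  apply: expr_small; last by rewrite divr_gt0.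
  by rewrite subr_ge0 cylinder_mass_le1 ltrBlDr ltrDl cylinder_mass_gt0.
rewrite -EFinD; apply: finitely_covered_premeasure.
have cov : forall w, w \in words m L -> true -> finitely_covered F (cylinder w) delta
    (cylinder_mass w * (H + (2 * diam E) `^ s * (1 - cylinder_mass u) ^+ l)).
  move=> w; rewrite mem_words => /eqP wL _; apply: finitely_covered_cylinder.
  rewrite mulrCA -ler_pdivlMr ?mulr_gt0//; apply: le_trans rL.
  by rewrite -wL word_ratio_le.
apply: finitely_covered_sub (finitely_covered_bigU cov) _ _.
  move=> x [Fx _]; have [w wL wx] := attractor_cylinder L (FE x Fx).
  by exists w; rewrite mem_words wL.
rewrite -mulr_suml sum_cylinder_mass mul1r lerD2l mulrC.
by rewrite -ler_pdivlMr.
Unshelve. all: by end_near. Qed.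

End UpperBound.

(** * Lower bound for C^s(E) through the words hit by a ball *)

Definition hits x (d : R) (w : seq 'I_m) : bool :=
  `[< exists2 y, cylinder w y & edist x y <= d >].

(** Stand-in for the natural measure of the ball, approximating it from above. *)
Definition hit_mass k x d : R := \sum_(w <- words m k | hits x d w) cylinder_mass w.

Lemma hit_mass_antimono k l x d : hit_mass (k + l) x d <= hit_mass k x d.
Proof.
rewrite /hit_mass big_mkcond big_wordsD [leRHS]big_mkcond /=.
apply: ler_sum => u _; case: ifPn => [_|nu].
  rewrite -[leRHS]mulr1 -(sum_cylinder_mass l) mulr_sumr; apply: ler_sum => v _.
  rewrite cylinder_mass_cat; case: ifP => // _.
  by rewrite mulr_ge0// ltW// cylinder_mass_gt0.
apply: sumr_le0 => v _; case: ifPn => // /asboolP[y uvy xy].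
by case/asboolP: nu; exists y => //; exact: cylinder_prefix uvy.
Qed.

Definition meets_two_pieces x (d : R) : Prop :=
  exists i j y z, [/\ i != j, E y, E z, x = f i y & edist x (f j z) <= d].

Lemma other_letter i : exists j, i != j.
Proof.
have [->|i0] := eqVneq i (Ordinal (ltnW m_ge2)); last by exists (Ordinal (ltnW m_ge2)).
by exists (Ordinal m_ge2).
Qed.

(* The ball is pulled back along the coding of its centre until it meets two
   first-level pieces; both sides scale by r_i^s at each step. *)
Lemma hit_mass_le (K : R) k :
  0 <= K ->
  (forall x d, E x -> 0 < d -> meets_two_pieces x d ->
    K * hit_mass k x d <= (2 * d) `^ s) ->
  forall x d, E x -> 0 < d ->
    exists N0, forall N, (N0 <= N)%N -> K * hit_mass N x d <= (2 * d) `^ s.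
Proof.
move=> K0 Kk x d Ex d0.
(* Each pull-back divides the radius by some r_i <= r_max, so [l] of them bring it to at least R;
   the induction is on [l]. *)
have [l ld] : exists l, diam E * rmax r ^+ l <= d.
  have [|l] := @expr_small _ (rmax r) (d / diam E) _ (divr_gt0 d0 diam_gt0).
    by rewrite rmax_ge0 rmax_lt1.
  by rewrite ler_pdivlMr// mulrC; exists l.
elim: l x d Ex d0 ld => [|l IHl] x d Ex d0 ld.
  exists k => N kN; apply: (@le_trans _ _ (K * hit_mass k x d)).
    by rewrite ler_wpM2l// -(subnKC kN) hit_mass_antimono.
  (* Here R <= d, so the ball reaches every first-level piece. *)
  apply: Kk => //; have [i [y [Ey xi]]] := attractor_map_inv Ex.
  have [j ij] := other_letter i.
  exists i, j, y, y; split=> //; apply: le_trans ld; rewrite expr0 mulr1.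
  by apply: edist_le_diam => //; exact: attractor_map.
have [two|one] := pselect (meets_two_pieces x d).
  exists k => N kN; apply: (@le_trans _ _ (K * hit_mass k x d)); last exact: Kk.
  by rewrite ler_wpM2l// -(subnKC kN) hit_mass_antimono.
have [i [y [Ey xi]]] := attractor_map_inv Ex.
have ri0 := ratio_gt0 i.
have [||N0 IHN] := IHl y (d / r i) Ey; first exact: divr_gt0.
  rewrite ler_pdivlMr//; apply: le_trans ld; rewrite -mulrA exprS [rmax r * _]mulrC.
  by rewrite !ler_wpM2l ?exprn_ge0 ?rmax_ge0 ?ratio_le_rmax// ltW.
(* One letter is consumed by the pull-back: the ball meets only piece [i], so every hit word starts
   with [i] and its tail hits the rescaled ball. *)
exists N0.+1 => -[//|N] /= N0N.
have hitE j w : hits x d (j :: w) -> j = i /\ hits y (d / r i) w.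
  move=> /asboolP[_ /cylinder_consE[z wz ->] xz].
  have Ez := cylinder_attractor wz.
  have ji : j = i.
    by apply/eqP; apply: contra_notT one => ji; exists i, j, y, z; rewrite eq_sym.
  split=> //; apply/asboolP; exists z => //.
  by rewrite ler_pdivlMr// mulrC -edist_map -xi -ji.
have -> : (2 * d) `^ s = r i `^ s * (2 * (d / r i)) `^ s.
  rewrite -powRM; [|exact: ltW|by rewrite mulr_ge0// ltW// divr_gt0].
  by rewrite mulrCA [r i * _]mulrC divfK// gt_eqF.
apply: (@le_trans _ _ (r i `^ s * (K * hit_mass N y (d / r i)))); last first.
  by rewrite ler_wpM2l ?powR_ge0// IHN.
rewrite mulrCA ler_wpM2l// /hit_mass big_mkcond big_wordsS (bigD1 i)//=.
rewrite [X in _ + X]big1 ?addr0 => [|j ji]; last first.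
  by apply: big1 => w _; case: ifP => // /hitE[jij _]; rewrite jij eqxx in ji.
rewrite mulr_sumr [leRHS]big_mkcond /=; apply: ler_sum => w _.
rewrite cylinder_mass_cons.
case: ifP => [/hitE[_ ->]//|_]; case: ifP => // _.
by rewrite mulr_ge0 ?powR_ge0// ltW// cylinder_mass_gt0.
Qed.

(** Slightly enlarged balls form an open cover of the compact set E. At a common depth [N] every
    word is hit by a ball of a finite subcover, so the hit masses add up to at least 1 and bound the
    cost from below. *)
Lemma premeasure_ge (K delta : R) :
  (forall x d, E x -> 0 < d ->
    exists N0, forall N, (N0 <= N)%N -> K * hit_mass N x d <= (2 * d) `^ s) ->
  (K%:E <= centered_premeasure_at s E delta)%E.
Proof.
move=> Kball; apply: le_ereal_inf_tmp => _ [I [c [d [[Iok Icov] ->]]]].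
have term_ge0 l : I l -> (0 <= ((2 * d l) `^ s)%:E)%E.
  by move=> _; rewrite lee_fin powR_ge0.
rewrite leNgt; apply/negP => TK.
have T0 : (0 <= \esum_(l in I) ((2 * d l) `^ s)%:E)%E by exact: esum_ge0.
have [t tT] : exists t : R, (\esum_(l in I) ((2 * d l) `^ s)%:E)%E = t%:E.
  exists (fine (\esum_(l in I) ((2 * d l) `^ s)%:E)%E).
  by rewrite fineK// ge0_fin_numE// (lt_trans TK) ?ltry.
move: TK T0; rewrite tT lte_fin lee_fin => tK t0.
have [tau tau1 tauK] := mul_slack t0 tK.
have s0 := dim_gt0.
(* Enlarging the radii by [lam] multiplies the cost by [tau], which still leaves it below [K]. *)
pose lam := tau `^ s^-1.
have lam_s : lam `^ s = tau.
  by rewrite /lam -powRrM mulVf ?gt_eqF// powRr1// ltW// (lt_trans ltr01).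
have lam1 : 1 < lam.
  rewrite ltNge; apply/negP => lam1.
  have := powR_le_mono s0 (powR_ge0 _ _) lam1.
  by rewrite -/lam lam_s powR1 leNgt tau1.
have [[e Ee] cptE _] := E_attr.
move: cptE; rewrite compact_cover => cptE.
have [] := cptE nat I (fun l => [set y | edist (c l) y < lam * d l]).
- by move=> l _; exact: open_eball.
- move=> y /Icov[l Il cy]; exists l => //=; apply: le_lt_trans cy _.
  by have [_ d0 _] := Iok l Il; rewrite ltr_pMl.
move=> D DI Dcov.
have DI' l : l \in finmap.enum_fset D -> I l by move=> /DI; rewrite inE.
have [N DN] : exists N, forall l, l \in finmap.enum_fset D ->
    K * hit_mass N (c l) (lam * d l) <= (2 * (lam * d l)) `^ s.
  apply: (@eventually_all _ _ (fun l N =>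
    K * hit_mass N (c l) (lam * d l) <= (2 * (lam * d l)) `^ s)) => l lD.
  have [Ec d0 _] := Iok l (DI' l lD).
  by apply: Kball => //; rewrite mulr_gt0// (lt_trans ltr01).
have K0 : 0 <= K by exact/ltW/(le_lt_trans t0).
(* Each E_w contains the image of [e], which lies in some ball of the subcover. *)
have hit1 : 1 <= \sum_(l <- finmap.enum_fset D) hit_mass N (c l) (lam * d l).
  rewrite /hit_mass (exchange_big_dep xpredT)//= -(sum_cylinder_mass N).
  apply: ler_sum => w _.
  have Ew : E (word_map f w e) by apply: (@cylinder_attractor w); exists e.
  have [l /= lD cl] := Dcov _ Ew.
  rewrite big_mkcond (bigD1_seq l) ?finmap.fset_uniq//=.
  have -> : hits (c l) (lam * d l) w.
    by apply/asboolP; exists (word_map f w e); [exists e|exact: ltW].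
  rewrite ler_wpDr// sumr_ge0// => l' _; case: ifP => // _.
  exact/ltW/cylinder_mass_gt0.
have sum_le_t : \sum_(l <- finmap.enum_fset D) (2 * d l) `^ s <= t.
  rewrite -lee_fin -tT -sumEFin; apply: ereal_sup_ubound.
  exists [set` finmap.enum_fset D]; first by split => // l /DI'.
  by rewrite -fsbig_seq ?finmap.fset_uniq.
suff : K <= tau * t by rewrite leNgt tauK.
apply: (@le_trans _ _ (K * \sum_(l <- finmap.enum_fset D) hit_mass N (c l) (lam * d l))).
  by rewrite ler_peMr.
apply: (@le_trans _ _ (tau * \sum_(l <- finmap.enum_fset D) (2 * d l) `^ s)); last first.
  by rewrite ler_wpM2l// ltW// (lt_trans ltr01).
rewrite !mulr_sumr big_seq [leRHS]big_seq; apply: ler_sum => l lD.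
apply: le_trans (DN l lD) _; have [_ d0 _] := Iok l (DI' l lD).
have lam0 : 0 <= lam := powR_ge0 _ _.
have dl0 : 0 <= 2 * d l by rewrite mulr_ge0// ltW.
by rewrite mulrCA (powRM s lam0 dl0) lam_s.
Qed.

Lemma centered_hausdorff_ge (K : R) :
  (forall x d, E x -> 0 < d ->
    exists N0, forall N, (N0 <= N)%N -> K * hit_mass N x d <= (2 * d) `^ s) ->
  (K%:E <= centered_hausdorff s E)%E.
Proof.
move=> Kball; apply: le_trans (_ : _ <= centered_premeasure s E)%E _; last first.
  by apply: ereal_sup_ubound; exists E.
apply: lime_ge; first exact: premeasure_at_is_cvg.
by apply: nearW => delta; exact: premeasure_ge.
Qed.

(** * Comparison of C^s(E) with the output at step k *)

Section ApproximateMinimum.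
Variables (k q : nat).
Hypothesis k_gt0 : (0 < k)%N.
Hypothesis q_sep : diam E * rmax r ^+ q <= separation f E.

Local Notation mtilde := (approx_centered_hausdorff f r E s k).
Local Notation eps :=
  (error_bound s (diam E) (separation f E) (rmin r) (rmax r) q k).

Lemma approx_ratio_ge0 x d : 0 <= approx_ratio f r E s k x d.
Proof.
rewrite divr_ge0 ?powR_ge0// approx_measureE// sumr_ge0// => w _.
exact/ltW/cylinder_mass_gt0.
Qed.

Lemma mtilde_le x d : approx_pts f k x -> admissible_radii f E k x d ->
  mtilde <= approx_ratio f r E s k x d.
Proof.
move=> kx xd; apply: (@le_trans _ _ (inf [set approx_ratio f r E s k x d
    | d in admissible_radii f E k x])).
  apply: ge_inf; last by exists x.
  exists 0 => _ [y _ <-]; apply: inf_ge0 => _ [t _ <-]; exact: approx_ratio_ge0.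
apply: ge_inf; last by exists d.
by exists 0 => _ [t _ <-]; exact: approx_ratio_ge0.
Qed.

Lemma approx_ptsE x : approx_pts f k x ->
  exists2 u, size u = k & x = cylinder_pt u.
Proof. exact: (approx_ptsP _ k_gt0).1. Qed.

Lemma admissible_radiiP u d : size u = k ->
  admissible_radii f E k (cylinder_pt u) d <->
  exists v w, [/\ size v = k /\ size w = k, d = edist (cylinder_pt u) (cylinder_pt v),
    edist (cylinder_pt u) (cylinder_pt w) <= d & ohead w != ohead u].
Proof.
move=> uk; split.
  move=> [_ [/approx_ptsE[v vk ->] -> [_ [/approx_ptsE[w wk ->] wd]]]].
  by rewrite !word_of_cylinder_pt// => wu; exists v, w.
move=> [v [w [[vk wk] dv wd wu]]]; exists (cylinder_pt v); split=> //.
  by apply/approx_ptsP => //; exists v.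
exists (cylinder_pt w); split=> //; first by apply/approx_ptsP => //; exists w.
by rewrite !word_of_cylinder_pt.
Qed.

Lemma separation_le_head u v x y : cylinder u x -> cylinder v y ->
  size u = k -> size v = k -> ohead v != ohead u -> separation f E <= edist x y.
Proof.
case: u => [|i u] + + uk; first by move: k_gt0; rewrite -uk.
case: v => [|j v] + + vk; first by move: k_gt0; rewrite -vk.
move=> /cylinder_consE[a /cylinder_attractor Ea ->].
move=> /cylinder_consE[b /cylinder_attractor Eb ->] ji.
by apply: separation_le => //; rewrite eq_sym; apply: contraNneq ji => ->.
Qed.

Lemma level_other_head u : size u = k -> exists2 v, size v = k & ohead v != ohead u.
Proof.
case: u => [|i u] uk; first by move: k_gt0; rewrite -uk.
have [j ij] := other_letter i.
by exists (j :: u) => //=; rewrite eq_sym; apply: contraNneq ij => -[->].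
Qed.

(** Both index sets must be shown nonempty, because [inf] of the empty set is 0. *)
Lemma le_mtilde t :
  (forall x d, approx_pts f k x -> admissible_radii f E k x d ->
    t <= approx_ratio f r E s k x d) -> t <= mtilde.
Proof.
move=> tle; apply: lb_le_inf.
  have [[e Ee] _ _] := E_attr; have [w wk _] := attractor_cylinder k Ee.
  eexists; exists (cylinder_pt w); last by reflexivity.
  by apply/approx_ptsP => //; exists w.
move=> _ [x kx <-]; apply: lb_le_inf; last by move=> _ [d xd <-]; exact: tle.
have [u uk xu] := approx_ptsE kx; have [v vk vu] := level_other_head uk.
eexists; exists (edist x (cylinder_pt v)); last by reflexivity.
by rewrite xu; apply/admissible_radiiP => //; exists v, v.
Qed.

Lemma rmin_powR_gt0 : 0 < rmin r `^ (q%:R * s).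
Proof. exact/powR_gt0/rmin_gt0. Qed.

Lemma eps_ge0 : 0 <= eps.
Proof.
rewrite /error_bound /Qconst !mulr_ge0 ?invr_ge0 ?powR_ge0 ?exprn_ge0 ?rmax_ge0//.
- exact/ltW/dim_gt0.
- exact/ltW.
- by case: ifP; rewrite powR_ge0.
Qed.

Lemma enlarge_ratio mass d D : rmin r `^ (q%:R * s) <= mass ->
  separation f E <= d -> 0 <= D -> D <= diam E ->
  D <= d + 2 * level_radius k ->
  (2 * D) `^ s <= (2 * d) `^ s + eps * mass.
Proof.
move=> qmass cd D0 DR Dd; apply: le_trans (enlarge_radius q cd D0 DR Dd) _.
by rewrite lerD2l ler_wpM2l// eps_ge0.
Qed.

(** An admissible radius D exists whose ball contains the points of all hit words; then mtilde times
    the hit mass is at most (2D)^s, hence at most (2d)^s plus eps times the hit mass. *)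
Lemma mtilde_hit_mass x d : E x -> 0 < d -> meets_two_pieces x d ->
  (mtilde - eps) * hit_mass k x d <= (2 * d) `^ s.
Proof.
move=> Ex d0 [i [j [y [z [ij Ey Ez xi xz]]]]].
have cd : separation f E <= d.
  by apply: le_trans xz; rewrite xi; exact: separation_le.
have [u uk ux] := attractor_cylinder k Ex.
have [w wk wz] := attractor_cylinder k (attractor_map j Ez).
have hu : hits x d u by apply/asboolP; exists x => //; rewrite edistxx ltW.
have hw : hits x d w by apply/asboolP; exists (f j z).
have wu : ohead w != ohead u.
  move: ux wz; case: (u) (w) uk wk => [|i' u'] [|j' w'] uk wk;
    try by move: k_gt0; rewrite -?uk -?wk.
  rewrite xi => /cylinder_consE[a /cylinder_attractor Ea].
  move=> /(attractor_map_disj Ey Ea) ii /cylinder_consE[b /cylinder_attractor Eb].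
  move=> /(attractor_map_disj Ez Eb) jj; apply: contraNneq ij => /= -[].
  by rewrite -ii -jj => ->.
have u_words : u \in words m k by rewrite mem_words uk.
(* Among the hit words, [v] has the point farthest from that of [u]. As [w] is also hit and starts
   with another letter, this distance is admissible. *)
have [v [+ hv vmax]] := seq_argmax (fun v => edist (cylinder_pt u) (cylinder_pt v))
  u_words hu.
rewrite mem_words => /eqP vk; set D := edist (cylinder_pt u) (cylinder_pt v) in vmax.
have Epts a : size a = k -> E (cylinder_pt a).
  by move=> ak; exact: (cylinder_attractor (level_pt_in k_gt0 ak)).
have Dd : D <= d + 2 * level_radius k.
  case/asboolP: hv => b vb xb.
  have := edist_level_pts k_gt0 uk vk ux vb; rewrite -/D ler_norml => /andP[h _].
  by rewrite -lerBlDr; lra.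
have mass_ge : rmin r `^ (q%:R * s) <= hit_mass k x d.
  apply: (ball_mass_ge q_sep uk hu cd) => a ak near_a.
  have ac := level_pt_in k_gt0 ak.
  by apply/asboolP; exists (cylinder_pt a) => //; exact: near_a.
have mass0 := lt_le_trans rmin_powR_gt0 mass_ge.
have DE : (2 * D) `^ s <= (2 * d) `^ s + eps * hit_mass k x d.
  apply: enlarge_ratio mass_ge cd (edist_ge0 _ _) _ Dd.
  exact: edist_le_diam (Epts _ uk) (Epts _ vk).
have hit_le : hit_mass k x d <= approx_measure f r E s k (cball (cylinder_pt u) D).
  rewrite approx_measure_cballE// /hit_mass big_mkcond [leRHS]big_mkcond /=.
  rewrite big_seq [leRHS]big_seq; apply: ler_sum => a ak; case: ifP => [ha|_].
    by rewrite vmax.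
  by case: ifP => // _; exact/ltW/cylinder_mass_gt0.
have : mtilde <= approx_ratio f r E s k (cylinder_pt u) D.
  apply: mtilde_le; first by apply/approx_ptsP => //; exists u.
  apply/admissible_radiiP => //; exists v, w; split=> //.
  by apply: vmax => //; rewrite mem_words wk.
rewrite /approx_ratio ler_pdivlMr; last exact: lt_le_trans hit_le.
move=> mle; rewrite mulrBl lerBlDr; apply: le_trans DE; apply: le_trans mle.
rewrite ler_wpM2l//; apply: inf_ge0 => _ [a _ <-]; apply: inf_ge0 => _ [t _ <-].
exact: approx_ratio_ge0.
Qed.

Lemma mtilde_le_centered_hausdorff : ((mtilde - eps)%:E <= centered_hausdorff s E)%E.
Proof.
apply: centered_hausdorff_ge => x d Ex d0.
(* For a negative constant the bound is trivial, as hit masses are nonnegative. *)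
have [K0|K0] := leP 0 (mtilde - eps); first exact: hit_mass_le mtilde_hit_mass _ _ Ex d0.
exists 0%N => N _; apply: (@le_trans _ _ 0); last exact: powR_ge0.
apply: mulr_le0_ge0; first exact: ltW.
by apply: sumr_ge0 => w _; exact/ltW/cylinder_mass_gt0.
Qed.

(** The covering bound is applied to the words whose points lie in the ball; their mass is exactly
    the denominator of [approx_ratio]. *)
Lemma centered_hausdorff_le_approx_ratio x d :
  approx_pts f k x -> admissible_radii f E k x d ->
  (centered_hausdorff s E <= (approx_ratio f r E s k x d + eps)%:E)%E.
Proof.
move=> /approx_ptsE[u uk ->] /(admissible_radiiP _ uk)[v [w [[vk wk] dv wd wu]]].
have cd : separation f E <= d.
  apply: le_trans wd.
  exact: (separation_le_head (level_pt_in k_gt0 uk) (level_pt_in k_gt0 wk) uk wk wu).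
have d0 := lt_le_trans sep_gt0 cd.
have lr0 : 0 <= level_radius k by rewrite mulr_ge0 ?exprn_ge0 ?rmax_ge0// ltW.
pose G := [pred a | edist (cylinder_pt u) (cylinder_pt a) <= d].
(* The cap at [diam E] is harmless, no two points of E being farther apart, and keeps [D] in the
   range of the power estimate. *)
pose D := Num.min (d + 2 * level_radius k) (diam E).
have Gu : G u by rewrite /G /= edistxx ltW.
have D0 : 0 < D by rewrite lt_min diam_gt0 andbT ltr_wpDr// mulr_ge0.
have DE : D <= diam E by rewrite /D ge_min lexx orbT.
have Dd : D <= d + 2 * level_radius k by rewrite /D ge_min lexx.
have G_near a x' y : size a = k -> G a -> cylinder u x' -> cylinder a y ->
    edist x' y <= D.
  move=> ak Ga ux ay; have Ex := cylinder_attractor ux.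
  rewrite /D le_min (edist_le_diam Ex (cylinder_attractor ay)) andbT.
  have := edist_level_pts k_gt0 uk ak ux ay; rewrite ler_norml => /andP[_].
  by move: Ga; rewrite /G /=; lra.
apply: le_trans (centered_hausdorff_le uk Gu D0 DE G_near) _.
rewrite lee_fin /approx_ratio approx_measure_cballE//.
set mass := \sum_(a <- words m k | _) _.
have mass_ge : rmin r `^ (q%:R * s) <= mass.
  apply: (ball_mass_ge q_sep uk Gu cd) => a ak near_a.
  exact: near_a (level_pt_in k_gt0 uk) (level_pt_in k_gt0 ak).
have mass0 := lt_le_trans rmin_powR_gt0 mass_ge.
rewrite -[eps](mulfK (lt0r_neq0 mass0)) -mulrDl ler_pM2r ?invr_gt0//.
exact: enlarge_ratio mass_ge cd (ltW D0) DE Dd.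
Qed.

Lemma centered_hausdorff_le_mtilde : (centered_hausdorff s E <= (mtilde + eps)%:E)%E.
Proof.
have [[e Ee] _ _] := E_attr; have [u uk _] := attractor_cylinder k Ee.
have [v vk vu] := level_other_head uk.
have ku : approx_pts f k (cylinder_pt u) by apply/approx_ptsP => //; exists u.
(* A single admissible radius already excludes the value [+oo]. *)
have adm : admissible_radii f E k (cylinder_pt u) (edist (cylinder_pt u) (cylinder_pt v)).
  by apply/admissible_radiiP => //; exists v, v.
have := centered_hausdorff_le_approx_ratio.
case: (centered_hausdorff s E) => [C| |] Cle; last exact: leNye.
  rewrite lee_fin -lerBlDr; apply: le_mtilde => x d kx xd.
  by have := Cle x d kx xd; rewrite lee_fin lerBlDr.
by have := Cle _ _ ku adm.
Qed.

Lemma centered_hausdorff_approx :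
  (`|centered_hausdorff s E - mtilde%:E| <= eps%:E)%E.
Proof.
have := mtilde_le_centered_hausdorff; have := centered_hausdorff_le_mtilde.
case: (centered_hausdorff s E) => [C| |]//.
by rewrite -EFinB /= !lee_fin ler_norml => h1 h2; apply/andP; split; lra.
Qed.

End ApproximateMinimum.

End SelfSimilarSet.

(** * The error estimate, with R > 0 and c > 0 derived from the choice of q *)

Theorem theorem2 (R : realType) (n m : nat)
    (f : 'I_m -> 'rV[R]_n -> 'rV[R]_n) (r : 'I_m -> R) (E : set 'rV[R]_n)
    (s : R) (q k : nat) :
  (2 <= m)%N ->
  (forall i, contracting_similitude (f i) (r i)) ->
  is_attractor f E ->
  strong_separation f E ->
  \sum_i r i `^ s = 1 ->
  (0 < q)%N ->
  diam E * rmax r ^+ q <= separation f E < diam E * rmax r ^+ q.-1 ->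
  (0 < k)%N ->
  (`| centered_hausdorff s E - (approx_centered_hausdorff f r E s k)%:E |
     <= (error_bound s (diam E) (separation f E) (rmin r) (rmax r) q k)%:E)%E.
Proof.
move=> m2 f_sim E_attr E_ssc sum1 q0 /andP[q_sep sep_q] k0.
have rmax_gt0 : 0 < rmax r.
  exact: lt_le_trans (ratio_gt0 f_sim (Ordinal m2)) (ratio_le_rmax _ _).
(* The hypotheses on [q] give R r_max^q < R r_max^(q-1); for R <= 0 the factor r_max < 1 would
   reverse this. *)
have diam_gt0 : 0 < diam E.
  have := le_lt_trans q_sep sep_q; rewrite -[in X in X < _](prednK q0) exprSr.
  rewrite mulrA; apply: contraTT; rewrite -!leNgt => E0.
  have a0 : diam E * rmax r ^+ q.-1 <= 0 by rewrite mulr_le0_ge0// exprn_ge0// ltW.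
  by rewrite -[leLHS]mulr1 ler_wnM2l// ltW// (rmax_lt1 f_sim).
have sep_gt0 : 0 < separation f E.
  by apply: lt_le_trans q_sep; rewrite mulr_gt0// exprn_gt0.
exact: centered_hausdorff_approx.
Qed.
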